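(* Work in $\mathbb{R}^3$. The polynomial complexes $$0\to\mathcal{P}_r\otimes\mathbb{V}\xrightarrow{\operatorname{def}}\mathcal{P}_{r-1}\otimes\mathbb{S}\xrightarrow{\operatorname{inc}}\mathcal{P}_{r-3}\otimes\mathbb{S}\xrightarrow{\operatorname{div}}\mathcal{P}_{r-4}\otimes\mathbb{V}\to0\qquad(r\ge4),$$ $$0\to\mathcal{P}_r\xrightarrow{\operatorname{dev}\operatorname{hess}}\mathcal{P}_{r-2}\otimes(\mathbb{S}\cap\mathbb{T})\xrightarrow{\operatorname{sym}\operatorname{curl}}\mathcal{P}_{r-3}\otimes(\mathbb{S}\cap\mathbb{T})\xrightarrow{\operatorname{div}\operatorname{div}}\mathcal{P}_{r-5}\to0\qquad(r\ge5),$$ $$0\to\mathcal{P}_r\otimes\mathbb{V}\xrightarrow{\operatorname{dev}\operatorname{def}}\mathcal{P}_{r-1}\otimes(\mathbb{S}\cap\mathbb{T})\xrightarrow{\operatorname{cot}}\mathcal{P}_{r-4}\otimes(\mathbb{S}\cap\mathbb{T})\xrightarrow{\operatorname{div}}\mathcal{P}_{r-5}\otimes\mathbb{V}\to0\qquad(r\ge5)$$ are exact in degrees $>0$ (i.e. at every space except the first nonzero one), while their cohomologies in degree $0$ are, respectively, the $6$-dimensional space of infinitesimal rigid motions $\{x\mapsto a+b\times x:a,b\in\mathbb{R}^3\}$, the $5$-dimensional space $\ker(\operatorname{dev}\operatorname{hess})$, and the $10$-dimensional space $\ker(\operatorname{dev}\operatorname{def})$.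
   Context: $\mathcal{P}_s$ is the space of real polynomials on $\mathbb{R}^3$ of degree at most $s$. $\mathbb{V}=\mathbb{R}^3$; $\mathbb{S}$ and $\mathbb{T}$ are the spaces of symmetric, respectively trace-free, real $3\times3$ matrices. $\operatorname{sym}$ is the symmetric part and $\operatorname{dev}u=u-\frac13\operatorname{tr}(u)I$ the trace-free part of a matrix. $\operatorname{def}u=\frac12(\nabla u+(\nabla u)^T)$ is the symmetric gradient; $\operatorname{hess}=\operatorname{grad}\circ\operatorname{grad}$; $\operatorname{curl}$ and $\operatorname{div}$ act column-wise on matrix fields; $\operatorname{inc}u=\operatorname{curl}\big((\operatorname{curl}u)^T\big)$; $\operatorname{div}\operatorname{div}$ is the divergence of the (vector-valued) column-wise divergence. With $\mathcal{S}u:=u^T-\operatorname{tr}(u)I$ (invertible on $3\times3$ matrices, $\mathcal{S}^{-1}u=u^T-\frac12\operatorname{tr}(u)I$), $\operatorname{cot}:=\operatorname{curl}\circ\mathcal{S}^{-1}\circ\operatorname{curl}\circ\mathcal{S}^{-1}\circ\operatorname{curl}$ is the linearized Cotton–York operator. *)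

(* Defs.v *)
From HB Require Import structures.
From mathcomp Require Import all_boot all_order all_algebra.
From mathcomp Require Import reals.
From mathcomp Require Export mpoly.
Set Implicit Arguments.
Unset Strict Implicit.
Unset Printing Implicit Defensive.
Import GRing.Theory Num.Theory.
Local Open Scope ring_scope.

(* Polynomial scalar, vector and matrix fields on R^3.  The
   three types are modules over {mpoly R[3]}; real scalars c act through the
   constant polynomials c%:MP. *)
Notation sfield R := ({mpoly R[3]}^o).
Notation vfield R := 'cV[{mpoly R[3]}]_3.
Notation mfield R := 'M[{mpoly R[3]}]_3.

(* msize p is the degree of p plus one, and 0 for p = 0. *)
Definition Pscal (R : realType) (s : nat) (p : sfield R) : Prop :=
  (msize p <= s.+1)%N.

Definition PV (R : realType) (s : nat) (u : vfield R) : Prop :=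
  forall i, Pscal s (u i 0).

Definition PS (R : realType) (s : nat) (u : mfield R) : Prop :=
  (forall i j, Pscal s (u i j)) /\ u^T = u.

Definition PST (R : realType) (s : nat) (u : mfield R) : Prop :=
  PS s u /\ \tr u = 0.

Definition sym (R : realType) (u : mfield R) : mfield R :=
  (2^-1 : R)%:MP *: (u + u^T).

Definition dev (R : realType) (u : mfield R) : mfield R :=
  u - ((3^-1 : R)%:MP * \tr u)%:M.

Definition calS (R : realType) (u : mfield R) : mfield R :=
  u^T - (\tr u)%:M.

Definition calSinv (R : realType) (u : mfield R) : mfield R :=
  u^T - ((2^-1 : R)%:MP * \tr u)%:M.

Definition grad (R : realType) (p : sfield R) : vfield R :=
  \col_i mderiv i p.

(* Column-wise: the j-th column is the gradient of the j-th component, i.e.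
   the transpose of the Jacobian matrix. *)
Definition vgrad (R : realType) (u : vfield R) : mfield R :=
  \matrix_(i, j) grad (u j 0) i 0.

(* Indices i : 'I_3 are added modulo 3, so i, i + 1, i + 2 is a cyclic
   permutation of the three coordinates. *)
Definition curlv (R : realType) (v : vfield R) : vfield R :=
  \col_i (mderiv (i + 1) (v (i + 2) 0) - mderiv (i + 2) (v (i + 1) 0)).

Definition cross (R : realType) (b v : vfield R) : vfield R :=
  \col_i (b (i + 1) 0 * v (i + 2) 0 - b (i + 2) 0 * v (i + 1) 0).

Definition divv (R : realType) (v : vfield R) : sfield R :=
  \sum_i mderiv i (v i 0).

Definition curl (R : realType) (u : mfield R) : mfield R :=
  \matrix_(i, j) curlv (col j u) i 0.

Definition div (R : realType) (u : mfield R) : vfield R :=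
  \col_j divv (col j u).

Definition def (R : realType) (u : vfield R) : mfield R :=
  (2^-1 : R)%:MP *: (vgrad u + (vgrad u)^T).

Definition hess (R : realType) (p : sfield R) : mfield R := vgrad (grad p).

Definition inc (R : realType) (u : mfield R) : mfield R := curl (curl u)^T.

Definition divdiv (R : realType) (u : mfield R) : sfield R := divv (div u).

Definition cot (R : realType) (u : mfield R) : mfield R :=
  curl (calSinv (curl (calSinv (curl u)))).

Definition devhess (R : realType) (p : sfield R) : mfield R := dev (hess p).

Definition symcurl (R : realType) (u : mfield R) : mfield R := sym (curl u).

Definition devdef (R : realType) (u : vfield R) : mfield R := dev (def u).

Definition position (R : realType) : vfield R := \col_i 'X_i.

Definition const_field (R : realType) (a : 'cV[R]_3) : vfield R :=
  map_mx (fun c => c%:MP) a.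

Definition rigid_motion (R : realType) (u : vfield R) : Prop :=
  exists a b : 'cV[R]_3,
    u = const_field a + cross (const_field b) (position R).

Definition real_subspace (R : realType) (V : lmodType {mpoly R[3]})
    (A : V -> Prop) : Prop :=
  A 0 /\ forall (c : R) u v, A u -> A v -> A (c%:MP *: u + v).

Definition real_linear (R : realType) (V W : lmodType {mpoly R[3]})
    (f : V -> W) : Prop :=
  forall (c : R) u v, f (c%:MP *: u + v) = c%:MP *: f u + f v.

Definition real_dim (R : realType) (V : lmodType {mpoly R[3]})
    (A : V -> Prop) (n : nat) : Prop :=
  exists b : 'I_n -> V,
    (forall c : 'I_n -> R,
       \sum_i (c i)%:MP *: b i = 0 -> forall i, c i = 0) /\
    (forall v, A v <-> exists c : 'I_n -> R, v = \sum_i (c i)%:MP *: b i).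

(* 0 -> A0 -d0-> A1 -d1-> A2 -d2-> A3 -> 0 *)
Record is_complex (R : realType) (V0 V1 V2 V3 : lmodType {mpoly R[3]})
    (A0 : V0 -> Prop) (A1 : V1 -> Prop) (A2 : V2 -> Prop) (A3 : V3 -> Prop)
    (d0 : V0 -> V1) (d1 : V1 -> V2) (d2 : V2 -> V3) : Prop := IsComplex {
  complex_subspace : [/\ real_subspace A0, real_subspace A1,
                         real_subspace A2 & real_subspace A3];
  complex_linear : [/\ real_linear d0, real_linear d1 & real_linear d2];
  complex_map0 : forall u, A0 u -> A1 (d0 u);
  complex_map1 : forall u, A1 u -> A2 (d1 u);
  complex_map2 : forall u, A2 u -> A3 (d2 u);
  complex_comp01 : forall u, A0 u -> d1 (d0 u) = 0;
  complex_comp12 : forall u, A1 u -> d2 (d1 u) = 0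
}.

Definition exact_at (U V W : zmodType) (A : U -> Prop) (B : V -> Prop)
    (f : U -> V) (g : V -> W) : Prop :=
  forall v, (B v /\ g v = 0) <-> (exists2 u, A u & v = f u).

Definition exact_positive (U0 U1 U2 U3 : zmodType)
    (A0 : U0 -> Prop) (A1 : U1 -> Prop) (A2 : U2 -> Prop) (A3 : U3 -> Prop)
    (d0 : U0 -> U1) (d1 : U1 -> U2) (d2 : U2 -> U3) : Prop :=
  [/\ exact_at A0 A1 d0 d1,
      exact_at A1 A2 d1 d2
    & exact_at A2 A3 d2 (fun w : U3 => 0 : U3)].

(* Nothing but 0 maps into A0, so the cohomology there is the kernel of d0. *)
Definition H0 (U V : zmodType) (A : U -> Prop) (d : U -> V) (u : U) : Prop :=
  A u /\ d u = 0.

Lemma calSK (R : realType) : cancel (@calS R) (@calSinv R).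
Proof.
move=> u; rewrite /calS /calSinv linearB /= trmxK tr_scalar_mx.
rewrite linearB /= mxtrace_tr mxtrace_scalar.
have -> : (2^-1 : R)%:MP * (\tr u - \tr u *+ 3) = - \tr u :> {mpoly R[3]}.
  rewrite (_ : \tr u - \tr u *+ 3 = (2%:R : R)%:MP * - \tr u); last first.
    by rewrite mpolyC_nat mulr_natl mulNrn mulrSr opprD addrCA subrr addr0.
  by rewrite mulrA -mpolyCM mulVf ?mul1r // pnatr_eq0.
by rewrite raddfN /= opprK subrK.
Qed.

Lemma calSinvK (R : realType) : cancel (@calSinv R) (@calS R).
Proof.
move=> u; rewrite /calS /calSinv linearB /= trmxK tr_scalar_mx.
rewrite linearB /= mxtrace_tr mxtrace_scalar.
set t := \tr u; set h := (2^-1 : R)%:MP * t.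
have -> : t = h *+ 2.
  by rewrite /h -mulrnAl -[_ *+ 2]mulr_natl -mpolyC_nat -mpolyCM mulfV
             ?mul1r // pnatr_eq0.
by rewrite [h *+ 3]mulrSr opprD addrA subrr sub0r raddfN /= opprK subrK.
Qed.

(* Main.v *)
(* The complexes are obtained from the polynomial de Rham complex by diagram
   chasing.  Exactness of grad, curl, div on polynomials, with the expected
   degrees, comes from explicit antiderivatives in one variable, and applies to
   matrix fields column by column.  Writing mskw w for the matrix of v |-> w x v
   and axl for (twice) its inverse on skew-symmetric matrices, the connecting
   identities are
     curl (mskw w) = S (vgrad w),   div (mskw a) = curl a,
     curl (q I) = mskw (grad q),    axl (curl u) = - div (S u),
     tr (curl u) = - div (axl u).
   They show that the skew-symmetric and trace parts of a potential can be
   removed, or prescribed, by solving one more equation of the de Rham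
   complex. *)
From HB Require Import structures.
Require Import Defs.
From mathcomp Require Import all_boot all_order all_algebra.
From mathcomp Require Import reals mpoly ring.
Import GRing.Theory Num.Theory.
Local Open Scope ring_scope.

Set Implicit Arguments.
Unset Strict Implicit.
Unset Printing Implicit Defensive.

(** * Antiderivatives of polynomials *)

Section Antiderivative.
Variables (R : numFieldType) (n : nat).
Implicit Types (p : {mpoly R[n]}) (m : 'X_{1..n}) (i j : 'I_n).

(** The antiderivative in [X_i] that vanishes at [X_i = 0]. This normalisation makes it commute with
    the other partial derivatives. *)
Definition mprim i p : {mpoly R[n]} :=
  \sum_(m <- msupp p) (p@_m / (m i).+1%:R) *: 'X_[m + U_(i)].

Lemma mcoeff_mprim i p m : (mprim i p)@_(m + U_(i)) = p@_m / (m i).+1%:R.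
Proof.
rewrite [in RHS](mpolyE p) /mprim !raddf_sum /= mulr_suml.
apply: eq_bigr => k _; rewrite !mcoeffZ !mcoeffX eqm_add2r.
by case: eqP => [->|_]; rewrite ?mulr1 // !mulr0 mul0r.
Qed.

Lemma mcoeff_mprim0 i p m : m i = 0%N -> (mprim i p)@_m = 0.
Proof.
move=> mi0; rewrite raddf_sum big1 // => k _.
rewrite /= mcoeffZ mcoeffX; case: eqP => [km|_]; last by rewrite mulr0.
by move: mi0; rewrite -km mnmDE mnm1E eqxx addn1.
Qed.

(** Coefficients of a primitive are computed by this split: they vanish at monomials free of [X_i],
    and [mcoeff_mprim] gives the others. *)
Lemma mnm_caseU i m : m i = 0%N \/ exists m', m = (m' + U_(i))%MM.
Proof.
case mi: (m i) => [|k]; [by left | right; exists (m - U_(i))%MM].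
by rewrite submK // lep1mP mi.
Qed.

Lemma mderiv_mprim i p : mderiv i (mprim i p) = p.
Proof.
apply/mpolyP => m.
by rewrite mcoeff_deriv mcoeff_mprim -[LHS]mulr_natr divfK // pnatr_eq0.
Qed.

Lemma mderiv_mprimC i j p :
  i != j -> mderiv j (mprim i p) = mprim i (mderiv j p).
Proof.
move=> neq_ij; apply/mpolyP => m; rewrite mcoeff_deriv.
have [mi0|[k ->]] := mnm_caseU i m.
  by rewrite !mcoeff_mprim0 ?mul0rn // mnmDE mi0 mnm1E eq_sym (negbTE neq_ij).
rewrite -addmA [(U_(i) + _)%MM]addmC addmA !mcoeff_mprim mcoeff_deriv.
rewrite !mnmDE !mnm1E (negbTE neq_ij) [j == i]eq_sym (negbTE neq_ij).
by rewrite !addn0 mulrnAl.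
Qed.

Lemma msize_leP p s :
  reflect (forall m, (s <= mdeg m)%N -> p@_m = 0) (msize p <= s)%N.
Proof.
apply: (iffP idP) => [ps m sm|p0].
  by apply: memN_msupp_eq0; apply: msize_mdeg_ge; apply: leq_trans sm.
rewrite msizeE; apply/bigmax_leqP_seq => m; rewrite mcoeff_msupp => pm _.
by rewrite ltnNge; apply: contra pm => /p0/eqP.
Qed.

Lemma msize_mprim s i p : (msize p <= s)%N -> (msize (mprim i p) <= s.+1)%N.
Proof.
move=> /msize_leP ps; apply/msize_leP => m.
have [mi0|[k ->]] := mnm_caseU i m; first by rewrite mcoeff_mprim0.
by rewrite mcoeff_mprim mdegD mdeg1 addn1 => sk; rewrite ps // mul0r.
Qed.

Lemma msize_mderiv s i p : (msize p <= s.+1)%N -> (msize (mderiv i p) <= s)%N.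
Proof.
move=> /msize_leP ps; apply/msize_leP => m sm.
by rewrite mcoeff_deriv ps ?mul0rn // mdegD mdeg1 addn1.
Qed.

(** A nonconstant monomial contains some [X_i]; a positive multiple of its coefficient occurs in
    [mderiv i p], and the characteristic is zero. *)
Lemma mderiv_eq0 p : (forall i, mderiv i p = 0) -> p = (p@_0)%:MP.
Proof.
move=> dp0; apply: msize1_polyC; apply/msize_leP => m.
rewrite lt0n mdeg_eq0 => /eqP m0.
have [i mi] : exists i, m i != 0%N.
  apply/existsP; apply: contra_notT m0; rewrite negb_exists => /forallP mi0.
  by apply/mnmP => i; rewrite mnm0E; apply/eqP; have := mi0 i; rewrite negbK.
have [mi0|[k ->]] := mnm_caseU i m; first by rewrite mi0 in mi.
have /eqP := congr1 (mcoeff k) (dp0 i).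
by rewrite mcoeff_deriv mcoeff0 mulrn_eq0 /= => /eqP.
Qed.

End Antiderivative.

(** * Differential identities on R^3 *)

Lemma ord3_ind (P : 'I_3 -> Prop) : P 0 -> P 1 -> P 2 -> forall i, P i.
Proof.
move=> P0 P1 P2 [[|[|[|//]]] lti].
- by rewrite (_ : Ordinal lti = 0) //; apply: val_inj.
- by rewrite (_ : Ordinal lti = 1) //; apply: val_inj.
- by rewrite (_ : Ordinal lti = 2) //; apply: val_inj.
Qed.

Lemma ord3D : (((1 + 1)%R = 2 :> 'I_3) * ((1 + 2)%R = 0 :> 'I_3) *
  ((2 + 1)%R = 0 :> 'I_3) * ((2 + 2)%R = 1 :> 'I_3))%type.
Proof. by do !split; apply: val_inj. Qed.

Lemma sum_ord3 (V : nmodType) (F : 'I_3 -> V) : \sum_i F i = F 0 + F 1 + F 2.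
Proof.
rewrite !big_ord_recl big_ord0 addr0 addrA; congr (F _ + F _ + F _);
  exact: val_inj.
Qed.

Definition mskw (R : realType) (w : vfield R) : mfield R := \matrix_(i, j)
  (if j == i then 0 else if j == i + 1 then - w (i + 2) 0 else w (i + 1) 0).

Definition axl (R : realType) (m : mfield R) : vfield R :=
  \col_i (m (i + 2) (i + 1) - m (i + 1) (i + 2)).

(** At concrete indices the sums modulo 3 are evaluated by [ord3D] and derivatives are distributed,
    so that [ring] can take the remaining partial derivatives as atoms. *)
Ltac expand_fields :=
  rewrite /curl /div /divv /vgrad /curlv /mskw /axl /calS /calSinv /sym /dev
    /def /grad /mxtrace;
  rewrite ?(mxE, sum_ord3, ord3D, add0r, addr0) //=;
  rewrite ?(mxE, sum_ord3, ord3D, add0r, addr0) //=;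
  rewrite ?(mderivD, mderivB, mderivN, mderiv0, mderiv_mulC).

Ltac by_entries :=
  first [apply/colP; elim/ord3_ind | apply/matrixP; do 2 elim/ord3_ind | idtac];
  expand_fields.

Section Fields.
Variable R : realType.
Implicit Types (p q : sfield R) (u v w a b : vfield R) (m : mfield R).

Lemma curl_mskw w : curl (mskw w) = calS (vgrad w).
Proof. by by_entries; ring. Qed.

Lemma axl_curl m : axl (curl m) = - div (calS m).
Proof. by by_entries; ring. Qed.

Lemma div_mskw a : div (mskw a) = curlv a.
Proof. by by_entries; ring. Qed.

Lemma curl_scalar q : curl q%:M = mskw (grad q).
Proof. by by_entries; ring. Qed.

Lemma tr_curl m : \tr (curl m) = - divv (axl m).
Proof. by by_entries; ring. Qed.

Lemma axl_vgrad b : axl (vgrad b) = - curlv b.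
Proof. by by_entries; ring. Qed.

Lemma tr_vgrad b : \tr (vgrad b) = divv b.
Proof. by by_entries. Qed.

Lemma axl_mskw w : axl (mskw w) = w + w.
Proof. by by_entries; ring. Qed.

Lemma trmx_mskw w : (mskw w)^T = - mskw w.
Proof. by by_entries; ring. Qed.

Lemma tr_mskw w : \tr (mskw w) = 0.
Proof. by by_entries; ring. Qed.

Lemma axl_tr m : axl m^T = - axl m.
Proof. by by_entries; ring. Qed.

Lemma axl_scalar q : axl q%:M = 0.
Proof. by by_entries; ring. Qed.

Lemma curlv_grad p : curlv (grad p) = 0.
Proof.
(* Mixed partial derivatives are brought into one order so that they cancel. *)
by by_entries; rewrite ?[p^`M(0)^`M(1)]mderiv_comm ?[p^`M(0)^`M(2)]mderiv_comm
  ?[p^`M(1)^`M(2)]mderiv_comm subrr.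
Qed.

Lemma divv_curlv v : divv (curlv v) = 0.
Proof.
by_entries.
rewrite ![_^`M(0)^`M(1)]mderiv_comm ![_^`M(0)^`M(2)]mderiv_comm
  ![_^`M(1)^`M(2)]mderiv_comm; ring.
Qed.

Lemma sym_axlK m : sym m + mskw ((2^-1 : R)%:MP *: axl m) = m.
Proof.
(* For [ring], one half is an arbitrary constant; the relation that two halves make one is supplied
   by hand. *)
have h2 : (2^-1 : R)%:MP + (2^-1 : R)%:MP = 1 :> sfield R.
  by rewrite -mpolyCD -mulr2n -(mulr_natr 2^-1) mulVf // pnatr_eq0.
by by_entries; rewrite -[RHS]mul1r -h2; ring.
Qed.

End Fields.

(** * Linearity over the reals *)

Section Linearity.
Variable R : realType.

Lemma grad_is_linear : real_linear (@grad R).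
Proof. by move=> c u v; by_entries; rewrite ?linearP /=. Qed.

Lemma vgrad_is_linear : real_linear (@vgrad R).
Proof. by move=> c u v; by_entries. Qed.

Lemma divv_is_linear : real_linear (@divv R).
Proof. by move=> c u v; by_entries; rewrite /GRing.scale /=; ring. Qed.

Lemma curlv_is_linear : real_linear (@curlv R).
Proof. by move=> c u v; by_entries; ring. Qed.

Lemma div_is_linear : real_linear (@div R).
Proof. by move=> c u v; by_entries; ring. Qed.

Lemma curl_is_linear : real_linear (@curl R).
Proof. by move=> c u v; by_entries; ring. Qed.

Lemma sym_is_linear : real_linear (@sym R).
Proof. by move=> c u v; by_entries; ring. Qed.

Lemma dev_is_linear : real_linear (@dev R).
Proof. by move=> c u v; by_entries; ring. Qed.

Lemma mskw_is_linear : real_linear (@mskw R).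
Proof. by move=> c u v; by_entries; ring. Qed.

Lemma axl_is_linear : real_linear (@axl R).
Proof. by move=> c u v; by_entries; ring. Qed.

Lemma calS_is_linear : real_linear (@calS R).
Proof. by move=> c u v; by_entries; ring. Qed.

Lemma calSinv_is_linear : real_linear (@calSinv R).
Proof. by move=> c u v; by_entries; ring. Qed.

Lemma trmx_is_linear : real_linear (fun m : mfield R => m^T).
Proof. by move=> c u v; rewrite linearP. Qed.

Lemma real_linear_comp (U V W : lmodType {mpoly R[3]})
    (g : V -> W) (f : U -> V) :
  real_linear g -> real_linear f -> real_linear (g \o f).
Proof. by move=> lg lf c u v /=; rewrite lf lg. Qed.

(** The case [c = -1] gives differences. Differential operators are not linear over the polynomial
    ring, so only additivity is registered for the [raddf] lemmas; real scalars go through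
    [real_linearZ]. *)
Lemma real_linear_zmod (V W : lmodType {mpoly R[3]}) (f : V -> W) :
  real_linear f -> zmod_morphism f.
Proof.
move=> lf u v; have := lf (-1) v u.
by rewrite mpolyCN mpolyC1 !scaleN1r addrC => ->; rewrite addrC.
Qed.

HB.instance Definition _ :=
  GRing.isZmodMorphism.Build _ _ (@grad R) (real_linear_zmod grad_is_linear).
HB.instance Definition _ :=
  GRing.isZmodMorphism.Build _ _ (@vgrad R) (real_linear_zmod vgrad_is_linear).
HB.instance Definition _ :=
  GRing.isZmodMorphism.Build _ _ (@divv R) (real_linear_zmod divv_is_linear).
HB.instance Definition _ :=
  GRing.isZmodMorphism.Build _ _ (@curlv R) (real_linear_zmod curlv_is_linear).
HB.instance Definition _ :=
  GRing.isZmodMorphism.Build _ _ (@div R) (real_linear_zmod div_is_linear).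
HB.instance Definition _ :=
  GRing.isZmodMorphism.Build _ _ (@curl R) (real_linear_zmod curl_is_linear).
HB.instance Definition _ :=
  GRing.isZmodMorphism.Build _ _ (@sym R) (real_linear_zmod sym_is_linear).
HB.instance Definition _ :=
  GRing.isZmodMorphism.Build _ _ (@dev R) (real_linear_zmod dev_is_linear).
HB.instance Definition _ :=
  GRing.isZmodMorphism.Build _ _ (@mskw R) (real_linear_zmod mskw_is_linear).
HB.instance Definition _ :=
  GRing.isZmodMorphism.Build _ _ (@axl R) (real_linear_zmod axl_is_linear).
HB.instance Definition _ :=
  GRing.isZmodMorphism.Build _ _ (@calS R) (real_linear_zmod calS_is_linear).
HB.instance Definition _ :=
  GRing.isZmodMorphism.Build _ _ (@calSinv R)
    (real_linear_zmod calSinv_is_linear).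

Lemma real_linearZ (V W : lmodType {mpoly R[3]}) (f : {additive V -> W}) :
  real_linear f -> forall (c : R) u, f (c%:MP *: u) = c%:MP *: f u.
Proof. by move=> lf c u; have := lf c u 0; rewrite raddf0 !addr0. Qed.

End Linearity.

(** * Degrees and the polynomial de Rham complex *)

Section Degrees.
Variable R : realType.
Implicit Types (p q : sfield R) (u v w a b : vfield R) (m : mfield R).

Definition PM s m := forall i j, Pscal s (m i j).

Lemma Pscal_subspace s : real_subspace (@Pscal R s).
Proof.
split=> [|c p q ps qs]; first by rewrite /Pscal msize0.
rewrite /Pscal; apply/msize_leP => k sk.
by rewrite mcoeffD mcoeffCM !(msize_leP _ _ _ _ sk) ?mulr0 ?addr0.
Qed.

Lemma Pscal0 s : Pscal s (0 : sfield R).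
Proof. by have [] := Pscal_subspace s. Qed.

Lemma PscalZ s (c : R) p : Pscal s p -> Pscal s (c%:MP * p).
Proof.
by move=> ps; have := (Pscal_subspace s).2 c _ _ ps (Pscal0 s); rewrite addr0.
Qed.

Lemma PscalD s p q : Pscal s p -> Pscal s q -> Pscal s (p + q).
Proof.
move=> ps qs; have := (Pscal_subspace s).2 1 _ _ ps qs.
by rewrite mpolyC1 scale1r.
Qed.

Lemma PscalN s p : Pscal s p -> Pscal s (- p).
Proof. by rewrite /Pscal mmeasureN. Qed.

Lemma PscalB s p q : Pscal s p -> Pscal s q -> Pscal s (p - q).
Proof. by move=> ps qs; apply/PscalD/PscalN. Qed.

Lemma PscalMn s p k : Pscal s p -> Pscal s (p *+ k).
Proof.
move=> ps; elim: k => [|k IHk]; first exact: Pscal0.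
by rewrite mulrS; apply: PscalD.
Qed.

Lemma Pscal_mderiv s i p : Pscal s.+1 p -> Pscal s (mderiv i p).
Proof. exact: msize_mderiv. Qed.

Lemma Pscal_mprim s i p : Pscal s p -> Pscal s.+1 (mprim i p).
Proof. exact: msize_mprim. Qed.

Lemma Pscal_sum s (F : 'I_3 -> sfield R) :
  (forall i, Pscal s (F i)) -> Pscal s (\sum_i F i).
Proof.
by move=> Fs; elim/big_ind: _ => //; [apply: Pscal0 | apply: PscalD].
Qed.

Ltac degrees := rewrite /PV /PM; move=> *; rewrite ?mxE;
  repeat first
    [ done | exact: Pscal0 | apply: PscalB | apply: PscalD | apply: PscalN
    | apply: PscalMn | apply: PscalZ | apply: Pscal_sum => ? | rewrite mxE
    | apply: Pscal_mderiv | apply: Pscal_mprim | case: ifP => _].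

Lemma PV_grad s p : Pscal s.+1 p -> PV s (grad p).
Proof. by degrees. Qed.

Lemma PM_vgrad s v : PV s.+1 v -> PM s (vgrad v).
Proof. by degrees. Qed.

Lemma PM_curl s m : PM s.+1 m -> PM s (curl m).
Proof. by degrees. Qed.

Lemma Pscal_divv s v : PV s.+1 v -> Pscal s (divv v).
Proof. by degrees. Qed.

Lemma PV_div s m : PM s.+1 m -> PV s (div m).
Proof. by degrees. Qed.

Lemma PM_tr s m : PM s m -> PM s m^T.
Proof. by degrees. Qed.

Lemma Pscal_trace s m : PM s m -> Pscal s (\tr m).
Proof. by degrees. Qed.

Lemma PM_sym s m : PM s m -> PM s (sym m).
Proof. by degrees. Qed.

Lemma PM_dev s m : PM s m -> PM s (dev m).
Proof. by degrees. Qed.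

Lemma PM_calS s m : PM s m -> PM s (calS m).
Proof. by degrees. Qed.

Lemma PM_calSinv s m : PM s m -> PM s (calSinv m).
Proof. by degrees. Qed.

Lemma PM_mskw s w : PV s w -> PM s (mskw w).
Proof. by degrees. Qed.

Lemma PV_axl s m : PM s m -> PV s (axl m).
Proof. by degrees. Qed.

Lemma PM_scalar s p : Pscal s p -> PM s p%:M.
Proof. by degrees. Qed.

Lemma PV_subspace s : real_subspace (@PV R s).
Proof. by split; degrees. Qed.

Lemma PM_subspace s : real_subspace (PM s).
Proof. by split; degrees. Qed.

(** * Exactness of grad, curl and div *)

Lemma curlv_exact s v : PV s v -> curlv v = 0 ->
  exists2 p, Pscal s.+1 p & v = grad p.
Proof.
move=> vs /colP cv.
have [] := (cv 0, cv 1, cv 2); rewrite !mxE !(add0r, ord3D).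
move=> [/subr0_eq e12 /subr0_eq e20] /subr0_eq e01.
(* The coordinates are integrated in turn. Once [p0] accounts for the first component, the curl
   equations make the remainders [a1] and [a2] free of [X_0]. *)
pose p0 := mprim 0 (v 0 0).
pose a1 := v 1 0 - mderiv 1 p0; pose a2 := v 2 0 - mderiv 2 p0.
have da1 : mderiv 0 a1 = 0.
  by rewrite mderivB mderiv_comm mderiv_mprim e01 subrr.
have da2 : mderiv 0 a2 = 0.
  by rewrite mderivB mderiv_comm mderiv_mprim e20 subrr.
(* Since [a1] is free of [X_0], so is [p1]. The last remainder [b2] depends on [X_2] alone, so [p2]
   does not disturb the first two components. *)
pose p1 := mprim 1 a1; pose b2 := a2 - mderiv 2 p1.
have d0p1 : mderiv 0 p1 = 0.
  by rewrite mderiv_mprimC // da1 /mprim msupp0 big_nil.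
have db2 : mderiv 0 b2 = 0.
  by rewrite mderivB da2 mderiv_comm d0p1 mderiv0 subrr.
have db2' : mderiv 1 b2 = 0.
  rewrite mderivB mderiv_comm mderiv_mprim /a1 /a2 !mderivB e12.
  by rewrite [mderiv 2 (mderiv 1 p0)]mderiv_comm subrr.
pose p2 := mprim 2 b2.
exists (p0 + p1 + p2).
  have p0s : Pscal s.+1 p0 by apply: Pscal_mprim.
  have p1s : Pscal s.+1 p1.
    by apply/Pscal_mprim/PscalB/Pscal_mderiv.
  apply: PscalD; first exact: PscalD.
  apply/Pscal_mprim/PscalB/Pscal_mderiv => //.
  by apply/PscalB/Pscal_mderiv.
apply/colP; elim/ord3_ind; rewrite mxE !mderivD.
- rewrite d0p1 [mderiv 0 p2]mderiv_mprimC // db2 /mprim msupp0 big_nil !addr0.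
  by rewrite mderiv_mprim.
- rewrite [mderiv 1 p2]mderiv_mprimC // db2' /mprim msupp0 big_nil addr0.
  by rewrite mderiv_mprim addrC subrK.
- by rewrite mderiv_mprim /b2 /a2 -addrA [X in _ + X]addrC subrK addrC subrK.
Qed.

Definition col3 (p0 p1 p2 : sfield R) : vfield R :=
  \col_i (if i == 0 then p0 else if i == 1 then p1 else p2).

Lemma divv_exact s w : PV s w -> divv w = 0 ->
  exists2 v, PV s.+1 v & w = curlv v.
Proof.
move=> ws; rewrite /divv sum_ord3 => dw.
(* The potential is sought with third component zero, so the first two components of [w] are
   integrated along [X_2]. *)
pose p0 := mprim 2 (w 0 0); pose p1 := mprim 2 (w 1 0).
(* The correction for the third component. As [divv w = 0] makes [e] free of [X_2], integrating it
   along [X_0] leaves the first component of the curl alone. *)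
pose e := w 2 0 + mderiv 0 p0 + mderiv 1 p1.
have de : mderiv 2 e = 0.
  rewrite !mderivD [mderiv 2 (mderiv 0 _)]mderiv_comm.
  rewrite [mderiv 2 (mderiv 1 _)]mderiv_comm !mderiv_mprim -dw; ring.
exists (col3 p1 (mprim 0 e - p0) 0).
  have p0s : Pscal s.+1 p0 by apply: Pscal_mprim.
  have p1s : Pscal s.+1 p1 by apply: Pscal_mprim.
  elim/ord3_ind; rewrite mxE /=; [exact: p1s | | exact: Pscal0].
  apply: PscalB => //; apply: Pscal_mprim.
  by apply/PscalD/Pscal_mderiv => //; apply/PscalD/Pscal_mderiv.
apply/colP; elim/ord3_ind; rewrite !mxE !(add0r, addr0, ord3D) /=.
- rewrite mderiv0 mderivB mderiv_mprim mderiv_mprimC // de.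
  by rewrite /mprim msupp0 big_nil; ring.
- by rewrite mderiv0 mderiv_mprim subr0.
- by rewrite mderivB mderiv_mprim /e; ring.
Qed.

Lemma divv_surj s p : Pscal s p -> exists2 w, PV s.+1 w & p = divv w.
Proof.
move=> ps; exists (col3 (mprim 0 p) 0 0); first elim/ord3_ind.
- by rewrite mxE; apply: Pscal_mprim.
- by rewrite mxE; apply: Pscal0.
- by rewrite mxE; apply: Pscal0.
by rewrite /divv sum_ord3 !mxE /= mderiv_mprim !mderiv0 !addr0.
Qed.

Lemma curl_exact s m : PM s m -> curl m = 0 ->
  exists2 v, PV s.+1 v & m = vgrad v.
Proof.
move=> ms cm.
have ex j : exists2 p, Pscal s.+1 p & col j m = grad p.
  apply: curlv_exact => [i|]; first by rewrite mxE.
  by apply/colP => i; have /matrixP/(_ i j) := cm; rewrite !mxE.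
have [F Fs FE] := fin_all_exists2 ex.
exists (\col_j F j) => [i|]; first by rewrite mxE.
by apply/matrixP => i j; have /colP/(_ i) := FE j; rewrite !mxE => ->.
Qed.

Lemma div_exact s m : PM s m -> div m = 0 ->
  exists2 t, PM s.+1 t & m = curl t.
Proof.
move=> ms dm.
have ex j : exists2 v, PV s.+1 v & col j m = curlv v.
  apply: divv_exact => [i|]; first by rewrite mxE.
  by have /colP/(_ j) := dm; rewrite !mxE.
have [F Fs FE] := fin_all_exists2 ex.
exists (\matrix_(i, j) F j i 0) => [i j|]; first by rewrite mxE; apply: Fs.
by apply/matrixP => i j; have /colP/(_ i) := FE j; rewrite !mxE => ->.
Qed.

Lemma div_surj s v : PV s v -> exists2 m, PM s.+1 m & v = div m.
Proof.
move=> vs.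
have [F Fs FE] := fin_all_exists2 (fun j => divv_surj (vs j)).
exists (\matrix_(i, j) F j i 0) => [i j|]; first by rewrite mxE; apply: Fs.
apply/colP => j; rewrite mxE FE; congr divv.
by apply/colP => i; rewrite !mxE.
Qed.

Lemma grad_eq0 p : grad p = 0 -> exists c : R, p = c%:MP.
Proof.
move=> /colP gp; exists p@_0; apply: mderiv_eq0 => i.
by have := gp i; rewrite !mxE.
Qed.

Lemma vgrad_eq0 v : vgrad v = 0 -> exists c : 'cV[R]_3, v = const_field c.
Proof.
move=> /matrixP gv.
have [i|c cE] := fin_all_exists (fun j => grad_eq0 (p := v j 0) _).
  by apply/colP => k; have := gv k i; rewrite !mxE.
by exists (\col_j c j); apply/colP => j; rewrite !mxE.
Qed.

End Degrees.

(** * The diagram chases *)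

Section Complexes.
Variable R : realType.
Implicit Types (p q : sfield R) (u v w a b : vfield R) (m : mfield R).

Local Notation half := ((2^-1 : R)%:MP : {mpoly R[3]}).

(** * Symmetric, skew-symmetric and trace parts *)

Lemma scale_half_addrr (V : lmodType {mpoly R[3]}) (x : V) :
  half *: (x + x) = x.
Proof.
by rewrite -mulr2n -scaler_nat scalerA -mpolyC_nat -mpolyCM mulVf
  ?pnatr_eq0 // scale1r.
Qed.

Lemma symE m : sym m = m - mskw (half *: axl m).
Proof. by rewrite -{2}[m]sym_axlK addrK. Qed.

Lemma sym_id m : m^T = m -> sym m = m.
Proof. by move=> mT; rewrite /sym mT scale_half_addrr. Qed.

Lemma trmx_sym m : (sym m)^T = sym m.
Proof. by rewrite /sym linearZ linearD /= trmxK addrC. Qed.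

Lemma tr_sym m : \tr (sym m) = \tr m.
Proof. by rewrite symE raddfB /= tr_mskw subr0. Qed.

Lemma sym_mskw w : sym (mskw w) = 0.
Proof. by rewrite /sym trmx_mskw subrr scaler0. Qed.

Lemma sym_eq0 m : sym m = 0 -> m = mskw (half *: axl m).
Proof. by move=> m0; rewrite -{1}[m]sym_axlK m0 add0r. Qed.

Lemma axl_eq0 m : axl m = 0 <-> m^T = m.
Proof.
split=> [m0|mT].
  by rewrite -[m]sym_axlK m0 scaler0 raddf0 addr0 trmx_sym.
by apply/colP => i; rewrite !mxE -{1}mT mxE subrr.
Qed.

Lemma calS_mskw w : calS (mskw w) = - mskw w.
Proof. by rewrite /calS tr_mskw trmx_mskw raddf0 subr0. Qed.

Lemma calSinv_mskw w : calSinv (mskw w) = - mskw w.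
Proof. by rewrite /calSinv tr_mskw trmx_mskw mulr0 raddf0 subr0. Qed.

Lemma calSinv_tr0 m : \tr m = 0 -> calSinv m = m^T.
Proof. by move=> m0; rewrite /calSinv m0 mulr0 raddf0 subr0. Qed.

Lemma axl_calSinv m : axl (calSinv m) = - axl m.
Proof. by rewrite /calSinv raddfB /= axl_tr axl_scalar subr0. Qed.

Lemma tr_dev m : \tr (dev m) = 0.
Proof.
rewrite /dev raddfB /= mxtrace_scalar -mulrnAl -mpolyCMn -[_ *+ 3]mulr_natr.
by rewrite mulVf ?pnatr_eq0 // mul1r subrr.
Qed.

Lemma trmx_dev m : (dev m)^T = dev m^T.
Proof. by rewrite /dev linearB /= tr_scalar_mx mxtrace_tr. Qed.

Lemma dev_tr0 m : \tr m = 0 -> dev m = m.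
Proof. by move=> m0; rewrite /dev m0 mulr0 raddf0 subr0. Qed.

Lemma dev_scalar q : dev q%:M = 0 :> mfield R.
Proof.
rewrite /dev mxtrace_scalar mulrnAr -mulrnAl -mpolyCMn -[_ *+ 3]mulr_natr.
by rewrite mulVf ?pnatr_eq0 // mul1r subrr.
Qed.

Lemma curl_vgrad v : curl (vgrad v) = 0.
Proof.
apply/matrixP => i j.
have -> : curl (vgrad v) i j = curlv (grad (v j 0)) i 0 by rewrite !mxE.
by rewrite curlv_grad !mxE.
Qed.

Lemma div_curl m : div (curl m) = 0.
Proof.
apply/colP => j; rewrite !mxE.
have -> : col j (curl m) = curlv (col j m) by apply/colP => i; rewrite !mxE.
exact: divv_curlv.
Qed.

(* The composition [curl \o calSinv \o curl] agrees with [inc] on symmetric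
   fields but, unlike [inc], kills skew-symmetric ones. *)
Definition inc_ext m : mfield R := curl (calSinv (curl m)).

Lemma cotE m : cot m = inc_ext (calSinv (curl m)). Proof. by []. Qed.

Lemma inc_ext_is_linear : real_linear inc_ext.
Proof.
exact: real_linear_comp (@curl_is_linear R)
  (real_linear_comp (@calSinv_is_linear R) (@curl_is_linear R)).
Qed.

HB.instance Definition _ :=
  GRing.isZmodMorphism.Build _ _ inc_ext (real_linear_zmod inc_ext_is_linear).

Lemma cot_is_linear : real_linear (@cot R).
Proof.
exact: real_linear_comp inc_ext_is_linear
  (real_linear_comp (@calSinv_is_linear R) (@curl_is_linear R)).
Qed.

HB.instance Definition _ :=
  GRing.isZmodMorphism.Build _ _ (@cot R) (real_linear_zmod cot_is_linear).

Lemma tr_curl_sym m : m^T = m -> \tr (curl m) = 0.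
Proof. by move/axl_eq0 => m0; rewrite tr_curl m0 raddf0 oppr0. Qed.

(** The curl of a symmetric field is trace-free, and on trace-free matrices [calSinv] is the
    transpose. *)
Lemma incE m : m^T = m -> inc m = inc_ext m.
Proof.
by move=> mT; rewrite /inc /inc_ext calSinv_tr0 ?tr_curl_sym.
Qed.

Lemma inc_ext_mskw w : inc_ext (mskw w) = 0.
Proof. by rewrite /inc_ext curl_mskw calSK curl_vgrad. Qed.

Lemma inc_ext_vgrad v : inc_ext (vgrad v) = 0.
Proof. by rewrite /inc_ext curl_vgrad !raddf0. Qed.

Lemma inc_ext_sym m : inc_ext (sym m) = inc_ext m.
Proof. by rewrite symE raddfB /= inc_ext_mskw subr0. Qed.

(** By [axl_curl] the skew part is governed by [div (calS (calSinv (curl m)))], which is the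
    divergence of a curl. *)
Lemma trmx_inc_ext m : (inc_ext m)^T = inc_ext m.
Proof.
by apply/axl_eq0; rewrite axl_curl calSinvK div_curl oppr0.
Qed.

(** This links the deformation complexes to the conformal Hessian complex: controlling a trace
    becomes a [divdiv] equation. *)
Lemma tr_inc_ext m : \tr (inc_ext m) = - divdiv (calS m).
Proof.
by rewrite /inc_ext tr_curl axl_calSinv axl_curl opprK.
Qed.

Lemma div_inc_ext m : div (inc_ext m) = 0.
Proof. exact: div_curl. Qed.

Lemma cot_mskw w : cot (mskw w) = 0.
Proof. by rewrite cotE curl_mskw calSK inc_ext_vgrad. Qed.

(** The first curl turns a scalar field into a skew one, which [inc_ext] kills. With [cot_mskw],
    only the trace-free symmetric part matters to [cot]. *)
Lemma cot_scalar q : cot q%:M = 0 :> mfield R.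
Proof.
by rewrite cotE curl_scalar calSinv_mskw raddfN /= inc_ext_mskw oppr0.
Qed.

Lemma cot_vgrad v : cot (vgrad v) = 0.
Proof. by rewrite cotE curl_vgrad !raddf0. Qed.

Lemma cot_dev m : cot (dev m) = cot m.
Proof. by rewrite /dev raddfB /= cot_scalar subr0. Qed.

Lemma cot_sym m : cot (sym m) = cot m.
Proof. by rewrite symE raddfB /= cot_mskw subr0. Qed.

Lemma trmx_cot m : (cot m)^T = cot m.
Proof. exact: trmx_inc_ext. Qed.

Lemma tr_cot m : \tr (cot m) = 0.
Proof. by rewrite cotE tr_inc_ext calSinvK /divdiv div_curl raddf0 oppr0. Qed.

Lemma divdiv_sym m : divdiv (sym m) = divdiv m.
Proof.
by rewrite /divdiv symE !raddfB /= div_mskw divv_curlv subr0.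
Qed.

Lemma symcurl_dev m : symcurl (dev m) = symcurl m.
Proof.
by rewrite /symcurl /dev !raddfB /= curl_scalar sym_mskw subr0.
Qed.

Lemma hess_sym p : (hess p)^T = hess p.
Proof. by apply/axl_eq0; rewrite axl_vgrad curlv_grad oppr0. Qed.

Lemma defE u : def u = sym (vgrad u). Proof. by []. Qed.

(** * Degrees and symmetry of the composite operators *)

Lemma PSsym s m : PM s m -> PS s (sym m).
Proof. by split; [apply: PM_sym | apply: trmx_sym]. Qed.

Lemma PSTdev s m : PS s m -> PST s (dev m).
Proof.
case=> ms mT; split; last exact: tr_dev.
by split; [apply: PM_dev | rewrite trmx_dev mT].
Qed.

Lemma PSTsym s m : PM s m -> \tr m = 0 -> PST s (sym m).
Proof. by move=> ms m0; split; [apply: PSsym | rewrite tr_sym]. Qed.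

Lemma PM_B s m m' : PM s m -> PM s m' -> PM s (m - m').
Proof. by move=> ms ms' i j; rewrite !mxE; apply: PscalB. Qed.

Lemma PM_D s m m' : PM s m -> PM s m' -> PM s (m + m').
Proof. by move=> ms ms' i j; rewrite mxE; apply: PscalD. Qed.

Lemma PV_half s v : PV s v -> PV s (half *: v).
Proof. by move=> vs i; rewrite mxE; apply: PscalZ. Qed.

Lemma PM_inc_ext s m : PM s.+2 m -> PM s (inc_ext m).
Proof. by move=> ms; apply/PM_curl/PM_calSinv/PM_curl. Qed.

Lemma PM_cot s m : PM s.+3 m -> PM s (cot m).
Proof. by move=> ms; apply/PM_inc_ext/PM_calSinv/PM_curl. Qed.

Lemma PST_cot s m : PM s.+3 m -> PST s (cot m).
Proof.
move=> ms; split; last exact: tr_cot.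
by split; [apply: PM_cot | apply: trmx_cot].
Qed.

(** * Exactness of the elasticity complex *)

Lemma inc_exact s m : PS s.+1 m -> inc m = 0 ->
  exists2 u, PV s.+2 u & m = def u.
Proof.
case=> ms mT im.
have [|w ws wE] := @curl_exact _ s _ _ im; first by apply/PM_tr/PM_curl/ms.
have divw : divv w = 0.
  by rewrite -tr_vgrad -wE mxtrace_tr tr_curl_sym.
(* As [vgrad w] is the transpose of the trace-free [curl m], [calS (vgrad w) = curl m]; by
   [curl_mskw], [mskw w] and [m] have the same curl. *)
have [||u us uE] := @curl_exact _ s.+1 (m - mskw w).
- by apply: PM_B => //; apply: PM_mskw.
- by rewrite raddfB /= curl_mskw /calS -wE trmxK mxtrace_tr tr_curl_sym //
    raddf0 subr0 subrr.
exists u => //.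
by rewrite defE -uE raddfB /= sym_mskw subr0 sym_id.
Qed.

(** Symmetry of [m = curl t] says that [div (calS t) = 0], so [calS t] is again a curl. *)
Lemma div_sym_exact s m : PS s m -> div m = 0 ->
  exists2 t, PM s.+2 t & m = inc_ext t.
Proof.
case=> ms /axl_eq0 m0 dm.
have [t ts mE] := div_exact ms dm.
have [||g gs gE] := @div_exact _ s.+1 (calS t).
- exact: PM_calS.
- by apply: oppr_inj; rewrite -axl_curl -mE m0 oppr0.
by exists g => //; rewrite mE /inc_ext -gE calSK.
Qed.

Lemma div_inc_exact s m : PS s m -> div m = 0 ->
  exists2 t, PS s.+2 t & m = inc t.
Proof.
move=> ms dm; have [t ts mE] := div_sym_exact ms dm.
exists (sym t); first exact: PSsym.
by rewrite incE; [rewrite inc_ext_sym | apply: trmx_sym].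
Qed.

(** Adding [curl (calSinv t)] keeps the divergence and changes [axl] by [- div t]; [t] is chosen to
    cancel the skew part of any preimage. *)
Lemma div_sym_surj s v : PV s v -> exists2 m, PS s.+1 m & v = div m.
Proof.
move=> vs; have [m ms ->] := div_surj vs.
have [t ts tE] := div_surj (PV_axl ms).
exists (m + curl (calSinv t)); last by rewrite raddfD /= div_curl addr0.
split; first by apply: PM_D => //; apply/PM_curl/PM_calSinv.
by apply/axl_eq0; rewrite raddfD /= axl_curl calSinvK tE subrr.
Qed.

(** * Exactness of the conformal Hessian complex *)

Lemma symcurl_exact s m : PST s.+1 m -> symcurl m = 0 ->
  exists2 p, Pscal s.+3 p & m = devhess p.
Proof.
move=> [[ms mT] m0] /sym_eq0; set w := _ *: _ => cm.
have ws : PV s w by apply/PV_half/PV_axl/PM_curl.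
(* Taking the divergence of [curl m = mskw w] gives [curlv w = 0]. With [w = grad q], the fields
   [q%:M] and [m] have the same curl. *)
have [|q qs wE] := @curlv_exact _ _ w ws.
  by rewrite -div_mskw -cm div_curl.
have [||v vs vE] := @curl_exact _ s.+1 (m - q%:M).
- by apply: PM_B => //; apply: PM_scalar.
- by rewrite raddfB /= curl_scalar -wE cm subrr.
(* Symmetry of [vgrad v] forces [curlv v = 0], so [m] is [hess p + q%:M], and [dev] removes the
   scalar term. *)
have [|p ps pE] := curlv_exact vs.
  apply: oppr_inj; rewrite -axl_vgrad -vE raddfB /= axl_scalar subr0 oppr0.
  exact/axl_eq0.
exists p => //; rewrite /devhess /hess -pE -vE raddfB /= dev_scalar subr0.
by rewrite dev_tr0.
Qed.

(** Subtracting [mskw a] absorbs [div m] and leaves some [curl t]. Since that is trace-free, [axl t]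
    is divergence-free, hence some [curlv b]; adding [vgrad b] symmetrises [t] without changing its
    curl. *)
Lemma divdiv_exact s m : PST s.+1 m -> divdiv m = 0 ->
  exists2 t, PST s.+2 t & m = symcurl t.
Proof.
move=> [[ms mT] m0] dm.
have [a as_ aE] := divv_exact (PV_div ms) dm.
have [||t ts tE] := @div_exact _ s.+1 (m - mskw a).
- by apply: PM_B => //; apply: PM_mskw.
- by rewrite raddfB /= div_mskw aE subrr.
have [|b bs bE] := divv_exact (PV_axl ts).
  by apply: oppr_inj; rewrite -tr_curl -tE raddfB /= m0 tr_mskw subrr oppr0.
exists (dev (t + vgrad b)).
  apply/PSTdev; split; first by apply: PM_D => //; apply: PM_vgrad.
  by apply/axl_eq0; rewrite raddfD /= axl_vgrad bE subrr.
rewrite symcurl_dev /symcurl raddfD /= curl_vgrad addr0 -tE raddfB /=.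
by rewrite sym_mskw subr0 sym_id.
Qed.

(** Two de Rham preimages give a matrix with the right [divdiv]. Adding [curl t] keeps the
    divergence and changes the trace by [- divv b]; symmetrising affects neither trace nor
    [divdiv]. *)
Lemma divdiv_surj s p : Pscal s p -> exists2 m, PST s.+2 m & p = divdiv m.
Proof.
move=> ps; have [v vs ->] := divv_surj ps; have [m ms ->] := div_surj vs.
have [b bs bE] := divv_surj (Pscal_trace ms).
pose t := mskw (half *: b).
have ts : PM s.+3 t by apply/PM_mskw/PV_half.
exists (sym (m + curl t)).
  apply: PSTsym; first by apply: PM_D => //; apply: PM_curl.
  by rewrite raddfD /= tr_curl axl_mskw -scalerDr scale_half_addrr bE subrr.
by rewrite divdiv_sym /divdiv !raddfD /= div_curl raddf0 addr0.
Qed.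

(** * Exactness of the conformal deformation complex *)

Lemma cot_exact s m : PST s.+2 m -> cot m = 0 ->
  exists2 u, PV s.+3 u & m = devdef u.
Proof.
move=> [[ms mT] m0] cm.
have cs : PM s.+1 (curl m) by apply: PM_curl.
(* The outermost curl in [cot m] is applied to some [vgrad w]. Hence [calSinv (curl m)] and [mskw w]
   have the same curl and differ by some [vgrad v]. *)
have [|w ws wE] := @curl_exact _ s _ _ cm.
  by apply/PM_calSinv/PM_curl/PM_calSinv/cs.
have [||v vs vE] := @curl_exact _ s.+1 (calSinv (curl m) - mskw w).
- by apply: PM_B; [apply: PM_calSinv | apply: PM_mskw].
- by rewrite raddfB /= curl_mskw -wE calSinvK subrr.
(* Applying [calS] turns [vgrad v] into [curl (mskw v)] and reverses the sign of [mskw w]. *)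
have cmE : curl m = curl (mskw v) - mskw w.
  by rewrite curl_mskw -vE raddfB /= calSinvK calS_mskw opprK addrK.
(* By [cmE], [mskw w] is a curl, so [w] is curl-free. With [w = grad q], [m] is a gradient up to a
   skew and a scalar field, which [sym] and [dev] remove. *)
have [|q qs qE] := curlv_exact ws.
  by rewrite -div_mskw -[mskw w](subKr (curl (mskw v))) -cmE raddfB /=
    !div_curl subrr.
have [||z zs zE] := @curl_exact _ s.+2 (m - mskw v + q%:M).
- by apply: PM_D; [apply: PM_B => //; apply: PM_mskw | apply: PM_scalar].
- by rewrite raddfD raddfB /= curl_scalar -qE cmE addrAC subrK subrr.
exists z => //; rewrite /devdef defE -zE.
have -> : sym (m - mskw v + q%:M) = m + q%:M.
  by rewrite raddfD raddfB /= sym_mskw subr0 !sym_id ?tr_scalar_mx.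
by rewrite raddfD /= dev_scalar addr0 dev_tr0.
Qed.

(** For [m = inc_ext g], trace-freeness reads [divdiv (calS g) = 0], so [calS g] is a curl up to
    some [mskw a]. This changes [g] by a skew field, which [inc_ext] kills. *)
Lemma div_cot_exact s m : PST s m -> div m = 0 ->
  exists2 t, PST s.+3 t & m = cot t.
Proof.
move=> [[ms mT] m0] dm.
have [g gs mE] := div_sym_exact (conj ms mT) dm.
have [|a as_ aE] := divv_exact (PV_div (PM_calS gs)).
  by apply: oppr_inj; rewrite -[- divv _]tr_inc_ext -mE m0 oppr0.
have [||t ts tE] := @div_exact _ s.+2 (calS g - mskw a).
- by apply: PM_B; [apply: PM_calS | apply: PM_mskw].
- by rewrite raddfB /= div_mskw aE subrr.
exists (dev (sym t)); first exact/PSTdev/PSsym.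
have ctE : calSinv (curl t) = g + mskw a.
  by rewrite -tE (raddfB (@calSinv R)) /= calSK calSinv_mskw opprK.
by rewrite cot_dev cot_sym cotE ctE raddfD /= inc_ext_mskw addr0.
Qed.

(** A symmetric preimage is made trace-free by adding an [inc_ext], which is symmetric and
    divergence-free; its trace is prescribed through surjectivity of [divdiv]. *)
Lemma div_symtr0_surj s v : PV s v -> exists2 m, PST s.+1 m & v = div m.
Proof.
move=> vs; have [m [ms mT] ->] := div_sym_surj vs.
have [t [[ts tT] t0] tE] := divdiv_surj (Pscal_trace ms).
exists (m + inc_ext (calSinv t)); last first.
  by rewrite raddfD /= div_inc_ext addr0.
split; last by rewrite raddfD /= tr_inc_ext calSinvK -tE subrr.
split; last by rewrite linearD /= trmx_inc_ext mT.
by apply: PM_D => //; apply/PM_inc_ext/PM_calSinv.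
Qed.

End Complexes.

(** * Kernels in degree 0 *)

Section Kernels.
Variable R : realType.
Implicit Types (p q : sfield R) (u v w : vfield R) (m : mfield R).
Implicit Types (a b d : 'cV[R]_3) (c e : R).

Local Notation half := ((2^-1 : R)%:MP : {mpoly R[3]}).
Local Notation X := (position R).

Definition lin d : sfield R := \sum_i (d i 0)%:MP * 'X_i.

Definition half_sqnorm : sfield R := half * \sum_i 'X_i * 'X_i.

(** Up to a constant factor, the generator of the special conformal transformations with parameter
    [d]. *)
Definition special_conformal d : vfield R :=
  lin d *: X - half_sqnorm *: const_field d.

Definition conformal_killing a b c d : vfield R :=
  const_field a + cross (const_field b) X + c%:MP *: X + special_conformal d.

Definition conformal_quadric c d e : sfield R :=
  c%:MP + lin d + e%:MP * half_sqnorm.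

Lemma mderivXU (i j : 'I_3) : mderiv i 'X_j = (i == j)%:R :> {mpoly R[3]}.
Proof.
rewrite mderivX mnm1E eq_sym; case: eqP => [->|_]; last by rewrite scale0r.
have -> : (U_(j) - U_(j))%MM = 0%MM.
  by apply/mnmP => k; rewrite mnmBE mnm0E subnn.
by rewrite mpolyX0 scale1r.
Qed.

Lemma mderiv_half_sqnorm i : mderiv i half_sqnorm = 'X_i.
Proof.
rewrite mderiv_mulC -[RHS](scale_half_addrr ('X_i : sfield R)).
congr (_ * _); rewrite raddf_sum (bigD1 i) //= big1 ?addr0.
  by rewrite mderivM mderivXU eqxx mul1r mulr1.
by move=> j /negbTE ji; rewrite mderivM mderivXU eq_sym ji mul0r mulr0 addr0.
Qed.

Lemma grad_half_sqnorm : grad half_sqnorm = X.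
Proof. by apply/colP => i; rewrite !mxE mderiv_half_sqnorm. Qed.

Lemma const_fieldN a : const_field (- a) = - const_field a.
Proof. by rewrite /const_field map_mxN. Qed.

Lemma const_field_eq0 a : const_field a = 0 -> a = 0.
Proof.
move=> /colP a0; apply/colP => i; have := a0 i.
by rewrite !mxE => /eqP; rewrite mpolyC_eq0 => /eqP.
Qed.

Lemma vgrad_const a : vgrad (const_field a) = 0.
Proof. by apply/matrixP => i j; rewrite !mxE mderivC. Qed.

Lemma grad_const c : grad (c%:MP : sfield R) = 0.
Proof. by apply/colP => i; rewrite !mxE mderivC. Qed.

(** The sign arises because [vgrad] is the transposed Jacobian. *)
Lemma vgrad_cross b : vgrad (cross (const_field b) X) = - mskw (const_field b).
Proof.
rewrite /cross /const_field /position.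
by by_entries; rewrite !mderivXU /=; ring.
Qed.

Lemma vgrad_position : vgrad X = 1%:M.
Proof. by apply/matrixP => i j; rewrite !mxE mderivXU. Qed.

Lemma grad_lin d : grad (lin d) = const_field d.
Proof.
rewrite /lin /const_field.
by by_entries; rewrite !mderivXU /=; ring.
Qed.

Lemma vgrad_special_conformal d :
  vgrad (special_conformal d) = - mskw (cross (const_field d) X) + (lin d)%:M.
Proof.
rewrite /special_conformal /cross /const_field /position /lin.
by_entries; rewrite !(mderivM, mderivD, mderivC, mderivXU,
  mderiv_half_sqnorm) /=; ring.
Qed.

Lemma scale_position_vgrad c : vgrad (c%:MP *: X) = (c%:MP : sfield R)%:M.
Proof.
by rewrite (real_linearZ (@vgrad_is_linear R)) /= vgrad_position
  scale_scalar_mx mulr1.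
Qed.

Lemma vgrad_conformal_killing a b c d :
  vgrad (conformal_killing a b c d) =
  - mskw (const_field b + cross (const_field d) X) + (c%:MP + lin d)%:M.
Proof.
rewrite /conformal_killing 3!(raddfD (@vgrad R)) /= vgrad_const add0r.
rewrite vgrad_cross scale_position_vgrad vgrad_special_conformal addrACA.
by rewrite (raddfD (@mskw R)) opprD [in RHS]raddfD.
Qed.

Lemma grad_conformal_quadric c d e :
  grad (conformal_quadric c d e) = const_field d + e%:MP *: X.
Proof.
rewrite /conformal_quadric 2!raddfD /= grad_const add0r grad_lin.
by rewrite (real_linearZ (@grad_is_linear R)) /= grad_half_sqnorm.
Qed.

Lemma hess_conformal_quadric c d e :
  hess (conformal_quadric c d e) = (e%:MP : sfield R)%:M.
Proof.
by rewrite /hess grad_conformal_quadric raddfD /= vgrad_const add0r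
  scale_position_vgrad.
Qed.

Lemma mskw_eq0 w : mskw w = 0 -> w = 0.
Proof.
move=> w0; rewrite -[w]scale_half_addrr -axl_mskw w0.
by rewrite raddf0 scaler0.
Qed.

Lemma calS_eq0 m : calS m = 0 -> m = 0.
Proof. by move=> m0; rewrite -[m]calSK m0 raddf0. Qed.

Lemma dev_eq0 m : dev m = 0 -> exists q, m = q%:M.
Proof. by move=> /subr0_eq ->; eexists. Qed.

(** If [vgrad u = mskw w], taking the curl gives [calS (vgrad w) = 0]. Hence [w] is constant, and
    [u] minus a rotation field is constant too. *)
Lemma def_eq0 u : def u = 0 <-> rigid_motion u.
Proof.
split=> [|[a [b ->]]]; last first.
  rewrite defE raddfD /= vgrad_const add0r vgrad_cross raddfN /=.
  by rewrite sym_mskw oppr0.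
rewrite defE => /sym_eq0; set w := _ *: _ => gu.
have /calS_eq0/vgrad_eq0[b wE] : calS (vgrad w) = 0.
  by rewrite -curl_mskw -gu curl_vgrad.
have /vgrad_eq0[a aE] : vgrad (u - cross (const_field (- b)) X) = 0.
  rewrite raddfB /= vgrad_cross const_fieldN (raddfN (@mskw R)) opprK.
  by rewrite gu wE subrr.
by exists a, (- b); rewrite -aE subrK.
Qed.

(** Two curls yield the closed system [vgrad u = q%:M + mskw w], [vgrad w = mskw (grad q)],
    [vgrad (grad q) = 0], which is integrated from the last equation back. *)
Lemma devdef_eq0 u :
  devdef u = 0 <-> exists a b c d, u = conformal_killing a b c d.
Proof.
split=> [/dev_eq0[q]|[a [b [c [d ->]]]]]; last first.
  rewrite /devdef defE vgrad_conformal_killing raddfD raddfN /= sym_mskw oppr0.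
  by rewrite add0r sym_id ?tr_scalar_mx // dev_scalar.
rewrite defE => su.
have := sym_axlK (vgrad u); rewrite su; set w := _ *: _ => gu.
have gw : vgrad w = mskw (grad q).
  apply: (can_inj (@calSK R)); rewrite calS_mskw -curl_mskw; apply/eqP.
  by rewrite -addr_eq0 -curl_scalar addrC -raddfD /= gu curl_vgrad.
have /calS_eq0/vgrad_eq0[d dE] : calS (vgrad (grad q)) = 0.
  by rewrite -curl_mskw -gw curl_vgrad.
have /grad_eq0[c cE] : grad (q - lin d) = 0.
  by rewrite raddfB /= grad_lin dE subrr.
have /vgrad_eq0[b bE] : vgrad (w + cross (const_field d) X) = 0.
  by rewrite raddfD /= vgrad_cross gw dE subrr.
have /vgrad_eq0[a aE] : vgrad (u - conformal_killing 0 (- b) c d) = 0.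
  rewrite raddfB /= vgrad_conformal_killing -gu -cE subrK const_fieldN -bE.
  rewrite (_ : - (w + _) + _ = - w); last by rewrite opprD subrK.
  by rewrite (raddfN (@mskw R)) opprK [mskw w + _]addrC subrr.
exists a, (- b), c, d; rewrite -[LHS](subrK (conformal_killing 0 (- b) c d)).
rewrite aE /conformal_killing !addrA; congr (_ + _ + _ + _).
by rewrite /const_field map_mx0 addr0.
Qed.

(** The curl of [hess p = q%:M] shows that [q] is constant; two integrations follow. *)
Lemma devhess_eq0 p :
  devhess p = 0 <-> exists c d e, p = conformal_quadric c d e.
Proof.
split=> [/dev_eq0[q hp]|[c [d [e ->]]]]; last first.
  by rewrite /devhess hess_conformal_quadric dev_scalar.
have /mskw_eq0/grad_eq0[e qE] : mskw (grad q) = 0.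
  by rewrite -curl_scalar -hp curl_vgrad.
have /vgrad_eq0[d dE] : vgrad (grad p - e%:MP *: X) = 0.
  by rewrite raddfB /= -/(hess p) hp qE scale_position_vgrad subrr.
have /grad_eq0[c cE] : grad (p - conformal_quadric 0 d e) = 0.
  by rewrite raddfB /= grad_conformal_quadric -dE subrK subrr.
exists c, d, e; rewrite -[LHS](subrK (conformal_quadric 0 d e)).
by rewrite cE /conformal_quadric mpolyC0 add0r addrA.
Qed.

(** * Uniqueness of the parameters, and dimensions *)

Lemma scalar_mx3_eq0 q : q%:M = 0 :> mfield R -> q = 0.
Proof. by move/matrixP/(_ 0 0); rewrite !mxE. Qed.

Lemma rigid_inj a b :
  const_field a + cross (const_field b) X = 0 -> a = 0 /\ b = 0.
Proof.
move=> ab0; have := congr1 (@vgrad R) ab0.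
rewrite raddfD raddf0 /= vgrad_const add0r vgrad_cross => /eqP.
rewrite oppr_eq0 => /eqP/mskw_eq0 b0; split; last exact: const_field_eq0.
apply: const_field_eq0; rewrite -[RHS]ab0 b0.
have -> : cross 0 X = 0 by apply/colP => i; rewrite !mxE !mul0r subrr.
by rewrite addr0.
Qed.

Lemma lin_const_inj c d : c%:MP + lin d = 0 -> c = 0 /\ d = 0.
Proof.
move=> cd0; have := congr1 (@grad R) cd0.
rewrite raddfD raddf0 /= grad_const add0r grad_lin => /const_field_eq0 d0.
split=> //; move/eqP: cd0; rewrite d0 /lin big1 ?addr0 ?mpolyC_eq0.
  by move/eqP.
by move=> i _; rewrite mxE mul0r.
Qed.

(** The symmetric part of the gradient isolates [c] and [d]; what is left is a rigid motion. *)
Lemma conformal_killing_inj a b c d :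
  conformal_killing a b c d = 0 -> [/\ a = 0, b = 0, c = 0 & d = 0].
Proof.
move=> F0; have := congr1 (@vgrad R) F0.
rewrite vgrad_conformal_killing raddf0 /= => gF0.
have := congr1 (@sym R) gF0.
rewrite raddfD raddfN raddf0 /= sym_mskw oppr0 add0r sym_id ?tr_scalar_mx //.
move=> /scalar_mx3_eq0/lin_const_inj[c0 d0].
have [a0 b0] : a = 0 /\ b = 0; last by [].
apply: rigid_inj; rewrite -[RHS]F0 /conformal_killing /special_conformal c0 d0.
rewrite mpolyC0 scale0r addr0 /const_field map_mx0 scaler0 subr0.
have -> : lin 0 = 0 by rewrite /lin big1 // => i _; rewrite mxE mul0r.
by rewrite scale0r addr0.
Qed.

Lemma conformal_quadric_inj c d e :
  conformal_quadric c d e = 0 -> [/\ c = 0, d = 0 & e = 0].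
Proof.
move=> F0; have := congr1 (@hess R) F0.
rewrite hess_conformal_quadric /hess !raddf0 => /scalar_mx3_eq0/eqP.
rewrite mpolyC_eq0 => /eqP e0.
have [c0 d0] : c = 0 /\ d = 0; last by [].
by apply: lin_const_inj; rewrite -[RHS]F0 /conformal_quadric e0 mul0r addr0.
Qed.

Lemma lin_linear c a b : lin (c *: a + b) = c%:MP * lin a + lin b.
Proof.
rewrite /lin mulr_sumr -big_split /=; apply: eq_bigr => i _.
by rewrite !mxE mpolyCD mpolyCM mulrDl mulrA.
Qed.

Lemma const_field_linear c a b :
  const_field (c *: a + b) = c%:MP *: const_field a + const_field b.
Proof. by apply/colP => i; rewrite !mxE mpolyCD mpolyCM. Qed.

Lemma cross_linear p u v w : cross (p *: u + v) w = p *: cross u w + cross v w.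
Proof. by apply/colP => i; rewrite !mxE; ring. Qed.

Lemma conformal_killing_linear e a b c d a' b' c' d' :
  conformal_killing (e *: a + a') (e *: b + b') (e * c + c') (e *: d + d') =
  e%:MP *: conformal_killing a b c d + conformal_killing a' b' c' d'.
Proof.
rewrite /conformal_killing /special_conformal lin_linear !const_field_linear.
rewrite cross_linear mpolyCD mpolyCM.
(* With the fields generalised, each entry is a polynomial identity within reach of [ring]. *)
move: (cross _ _) (cross _ _) => B B'.
move: (const_field a) (const_field a') => A A'.
move: (const_field d) (const_field d') => D D'.
move: half_sqnorm X (lin d) (lin d') => N Y L L'.
move: (e%:MP) (c%:MP) (c'%:MP) => E C C'.
apply/colP => i.
by rewrite !mxE; ring.
Qed.

(** The basis is the image of the unit vectors. Parameters are packed in a row vector so that block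
    splitting recovers them. *)
Lemma real_dim_param (V : lmodType {mpoly R[3]}) (A : V -> Prop) n
    (F : 'rV[R]_n -> V) :
  (forall c r s, F (c *: r + s) = c%:MP *: F r + F s) ->
  (forall r, F r = 0 -> r = 0) ->
  (forall x, A x <-> exists r, x = F r) -> real_dim A n.
Proof.
move=> linF injF AF; exists (fun i => F (delta_mx 0 i)).
have F0 : F 0 = 0.
  have := linF 1 0 0; rewrite scale1r addr0 mpolyC1 scale1r => /eqP.
  by rewrite -[X in X == _]addr0 (inj_eq (addrI _)) eq_sym => /eqP.
have FE r : F r = \sum_i (r 0 i)%:MP *: F (delta_mx 0 i).
  rewrite {1}(row_sum_delta r); elim/big_rec2: _ => // i y z _ e.
  by rewrite linF e.
split=> [c|v].
  rewrite (eq_bigr (fun i => ((\row_j c j) 0 i)%:MP *: F (delta_mx 0 i))).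
    by rewrite -FE => /injF/rowP c0 i; have := c0 i; rewrite !mxE.
  by move=> i _; rewrite mxE.
split=> [/AF[r ->]|[c ->]]; first by exists (r 0).
apply/AF; exists (\row_j c j); rewrite FE.
by apply: eq_bigr => i _; rewrite mxE.
Qed.

Lemma real_dim_rigid : real_dim (@rigid_motion R) 6.
Proof.
pose F (r : 'rV[R]_(3 + 3)) :=
  const_field (lsubmx r)^T + cross (const_field (rsubmx r)^T) X.
apply: (@real_dim_param _ _ _ F) => [c r s|r /rigid_inj[r1 r2]|v].
- apply/colP => i; rewrite /F /cross /const_field !mxE !(mpolyCD, mpolyCM).
  by ring.
- rewrite -[r]hsubmxK -[lsubmx r]trmxK -[rsubmx r]trmxK r1 r2.
  by rewrite trmx0 row_mx0.
split=> [[a [b ->]]|[r ->]]; last by exists (lsubmx r)^T, (rsubmx r)^T.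
by exists (row_mx a^T b^T); rewrite /F row_mxKl row_mxKr !trmxK.
Qed.

Lemma real_dim_devhess : real_dim (fun p : sfield R => devhess p = 0) 5.
Proof.
pose F (r : 'rV[R]_(1 + (3 + 1))) :=
  conformal_quadric (lsubmx r 0 0) (lsubmx (rsubmx r))^T
    (rsubmx (rsubmx r) 0 0).
apply: (@real_dim_param _ _ _ F)
  => [c r s|r /conformal_quadric_inj[r1 r2 r3]|v].
- rewrite /F !linearP /= !mxE /conformal_quadric lin_linear.
  by rewrite !(mpolyCD, mpolyCM) /GRing.scale /=; ring.
- rewrite -[r]hsubmxK -[rsubmx r]hsubmxK -[lsubmx (rsubmx r)]trmxK r2 trmx0.
  rewrite [lsubmx r]mx11_scalar r1 [rsubmx (rsubmx r)]mx11_scalar r3.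
  by rewrite !raddf0 !row_mx0.
rewrite devhess_eq0; split=> [[c [d [e ->]]]|[r ->]]; last first.
  by exists (lsubmx r 0 0), (lsubmx (rsubmx r))^T, (rsubmx (rsubmx r) 0 0).
exists (row_mx c%:M (row_mx d^T e%:M)).
by rewrite /F !(row_mxKl, row_mxKr) trmxK !mxE.
Qed.

Lemma real_dim_devdef : real_dim (fun u : vfield R => devdef u = 0) 10.
Proof.
(* The blocks hold translation, rotation, dilation and special conformal parameters. *)
pose F (r : 'rV[R]_(3 + (3 + (1 + 3)))) :=
  conformal_killing (lsubmx r)^T (lsubmx (rsubmx r))^T
    (lsubmx (rsubmx (rsubmx r)) 0 0) (rsubmx (rsubmx (rsubmx r)))^T.
apply: (@real_dim_param _ _ _ F)
  => [c r s|r /conformal_killing_inj[r1 r2 r3 r4]|v].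
- by rewrite /F !linearP /= !mxE conformal_killing_linear.
- rewrite -[r]hsubmxK -[rsubmx r]hsubmxK -[rsubmx (rsubmx r)]hsubmxK.
  rewrite -[lsubmx r]trmxK r1 -[lsubmx (rsubmx r)]trmxK r2.
  rewrite -[rsubmx (rsubmx (rsubmx r))]trmxK r4.
  by rewrite [lsubmx (rsubmx (rsubmx r))]mx11_scalar r3 !(raddf0, row_mx0).
rewrite devdef_eq0; split=> [[a [b [c [d ->]]]]|[r ->]]; last first.
  by exists (lsubmx r)^T, (lsubmx (rsubmx r))^T,
    (lsubmx (rsubmx (rsubmx r)) 0 0), (rsubmx (rsubmx (rsubmx r)))^T.
exists (row_mx a^T (row_mx b^T (row_mx c%:M d^T))).
by rewrite /F !(row_mxKl, row_mxKr) !trmxK !mxE.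
Qed.

(** * Degrees of the kernel fields *)

Lemma PscalC s c : Pscal s (c%:MP : sfield R).
Proof. by rewrite /Pscal msizeC; case: eqP. Qed.

Lemma PscalX s i : Pscal s.+1 ('X_i : sfield R).
Proof. by rewrite /Pscal msizeX mdeg1. Qed.

Lemma PscalM s t p q : Pscal s p -> Pscal t q -> Pscal (s + t) (p * q).
Proof.
rewrite /Pscal => ps qt.
(* Zero factors are set apart because [msizeM] concerns nonzero polynomials. *)
have [->|p0] := eqVneq p 0; first by rewrite mul0r msize0.
have [->|q0] := eqVneq q 0; first by rewrite mulr0 msize0.
rewrite msizeM //; apply: (@leq_trans (s.+1 + t.+1).-1); last by rewrite addnS.
by rewrite -!subn1 leq_sub2r // leq_add.
Qed.

Lemma PscalW s t p : (s <= t)%N -> Pscal s p -> Pscal t p.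
Proof. by move=> st ps; apply: leq_trans ps _. Qed.

Lemma Pscal_lin s d : Pscal s.+1 (lin d).
Proof. by apply: Pscal_sum => i; apply/PscalZ/PscalX. Qed.

Lemma Pscal_half_sqnorm s : Pscal s.+2 half_sqnorm.
Proof.
apply/PscalZ/Pscal_sum => i; apply: (@PscalW (1 + 1)) => //.
by apply: PscalM; apply: PscalX.
Qed.

(** This bound and the two below place each whole kernel inside the first space of its complex, so
    the cohomology there is the same for all admissible [r]. *)
Lemma PV_rigid s a b : PV s.+1 (const_field a + cross (const_field b) X).
Proof.
move=> i; rewrite !mxE; apply: PscalD; first exact: PscalC.
by apply: PscalB; apply/PscalZ/PscalX.
Qed.

Lemma PV_conformal_killing s a b c d : PV s.+2 (conformal_killing a b c d).
Proof.
move=> i; rewrite mxE [X in X + _]mxE; apply: PscalD.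
  by apply: PscalD; [apply: PV_rigid | rewrite !mxE; apply/PscalZ/PscalX].
rewrite !mxE; apply: PscalB.
  apply: (@PscalW (1 + 1)) => //.
  by apply: PscalM; [apply: Pscal_lin | apply: PscalX].
by rewrite mulrC; apply/PscalZ/Pscal_half_sqnorm.
Qed.

Lemma Pscal_conformal_quadric s c d e : Pscal s.+2 (conformal_quadric c d e).
Proof.
apply: PscalD; last exact/PscalZ/Pscal_half_sqnorm.
by apply: PscalD; [apply: PscalC | apply: Pscal_lin].
Qed.

End Kernels.

(** * The three complexes *)

Section Assembly.
Variable R : realType.

(** The complex property puts images inside kernels; the reverse inclusions and surjectivity
    remain. *)
Lemma exact_positive_of_complex (V0 V1 V2 V3 : lmodType {mpoly R[3]})
    (A0 : V0 -> Prop) (A1 : V1 -> Prop) (A2 : V2 -> Prop) (A3 : V3 -> Prop)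
    (d0 : V0 -> V1) (d1 : V1 -> V2) (d2 : V2 -> V3) :
  is_complex A0 A1 A2 A3 d0 d1 d2 ->
  (forall v, A1 v -> d1 v = 0 -> exists2 u, A0 u & v = d0 u) ->
  (forall v, A2 v -> d2 v = 0 -> exists2 u, A1 u & v = d1 u) ->
  (forall v, A3 v -> exists2 u, A2 u & v = d2 u) ->
  exact_positive A0 A1 A2 A3 d0 d1 d2.
Proof.
move=> [_ _ m0 m1 m2 c01 c12] e1 e2 e3; split=> v.
- by split=> [[]|[u Au ->]]; [exact: e1 | split; [exact: m0 | exact: c01]].
- by split=> [[]|[u Au ->]]; [exact: e2 | split; [exact: m1 | exact: c12]].
- by split=> [[/e3]|[u Au ->]] //; split=> //; exact: m2.
Qed.

Lemma PS_subspace s : real_subspace (@PS R s).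
Proof.
split=> [|c u v [us uT] [vs vT]].
  by split; [case: (PM_subspace R s) | rewrite trmx0].
by split; [apply: (PM_subspace R s).2 | rewrite linearP /= uT vT].
Qed.

Lemma PST_subspace s : real_subspace (@PST R s).
Proof.
split=> [|c u v [us u0] [vs v0]].
  by split; [case: (PS_subspace s) | rewrite raddf0].
split; first exact: (PS_subspace s).2.
by rewrite mxtraceD mxtraceZ u0 v0 mulr0 addr0.
Qed.

Lemma def_is_linear : real_linear (@def R).
Proof. exact: real_linear_comp (@sym_is_linear R) (@vgrad_is_linear R). Qed.

Lemma inc_is_linear : real_linear (@inc R).
Proof.
exact: real_linear_comp (@curl_is_linear R)
  (real_linear_comp (@trmx_is_linear R) (@curl_is_linear R)).
Qed.

Lemma devhess_is_linear : real_linear (@devhess R).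
Proof.
exact: real_linear_comp (@dev_is_linear R)
  (real_linear_comp (@vgrad_is_linear R) (@grad_is_linear R)).
Qed.

Lemma symcurl_is_linear : real_linear (@symcurl R).
Proof. exact: real_linear_comp (@sym_is_linear R) (@curl_is_linear R). Qed.

Lemma divdiv_is_linear : real_linear (@divdiv R).
Proof. exact: real_linear_comp (@divv_is_linear R) (@div_is_linear R). Qed.

Lemma devdef_is_linear : real_linear (@devdef R).
Proof. exact: real_linear_comp (@dev_is_linear R) def_is_linear. Qed.

(** Here [s] stands for [r - 4], and for [r - 5] in the next two complexes, which avoids truncated
    subtraction. *)
Lemma elasticity_is_complex s :
  is_complex (@PV R s.+4) (@PS R s.+3) (@PS R s.+1) (@PV R s)
    (@def R) (@inc R) (@div R).
Proof.
split.
- by split; [apply: PV_subspace | apply: PS_subspace | apply: PS_subspace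
    | apply: PV_subspace].
- by split; [apply: def_is_linear | apply: inc_is_linear
    | apply: div_is_linear].
- by move=> u us; apply/PSsym/PM_vgrad.
- move=> m [ms mT]; rewrite incE //.
  by split; [apply: PM_inc_ext | apply: trmx_inc_ext].
- by move=> m [ms _]; apply: PV_div.
- by move=> u _; rewrite incE ?trmx_sym // defE inc_ext_sym inc_ext_vgrad.
- by move=> m [_ mT]; rewrite incE // div_inc_ext.
Qed.

Lemma conformal_hessian_is_complex s :
  is_complex (@Pscal R s.+1.+4) (@PST R s.+3) (@PST R s.+2) (@Pscal R s)
    (@devhess R) (@symcurl R) (@divdiv R).
Proof.
split.
- by split; [apply: Pscal_subspace | apply: PST_subspace | apply: PST_subspace
    | apply: Pscal_subspace].
- by split; [apply: devhess_is_linear | apply: symcurl_is_linear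
    | apply: divdiv_is_linear].
- move=> p ps; apply: PSTdev; split; last exact: hess_sym.
  exact/PM_vgrad/PV_grad.
- move=> m [[ms mT] _]; apply: PSTsym; first exact: PM_curl.
  exact: tr_curl_sym.
- by move=> m [[ms _] _]; apply/Pscal_divv/PV_div.
- move=> p _; rewrite /devhess symcurl_dev /symcurl curl_vgrad.
  exact: raddf0.
- by move=> m _; rewrite /symcurl divdiv_sym /divdiv div_curl raddf0.
Qed.

Lemma conformal_deformation_is_complex s :
  is_complex (@PV R s.+1.+4) (@PST R s.+4) (@PST R s.+1) (@PV R s)
    (@devdef R) (@cot R) (@div R).
Proof.
split.
- by split; [apply: PV_subspace | apply: PST_subspace | apply: PST_subspace
    | apply: PV_subspace].
- by split; [apply: devdef_is_linear | apply: cot_is_linear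
    | apply: div_is_linear].
- by move=> u us; apply/PSTdev/PSsym/PM_vgrad.
- by move=> m [[ms _] _]; apply: PST_cot.
- by move=> m [[ms _] _]; apply: PV_div.
- by move=> u _; rewrite /devdef cot_dev defE cot_sym cot_vgrad.
- by move=> m _; rewrite cotE div_inc_ext.
Qed.

End Assembly.

Theorem theorem8 (R : realType) :
  (* elasticity complex *)
  (forall r : nat, (4 <= r)%N ->
    [/\ is_complex (@PV R r) (@PS R (r - 1)) (@PS R (r - 3)) (@PV R (r - 4))
          (@def R) (@inc R) (@div R),
        exact_positive (@PV R r) (@PS R (r - 1)) (@PS R (r - 3))
          (@PV R (r - 4)) (@def R) (@inc R) (@div R),
        (forall u, H0 (@PV R r) (@def R) u <-> rigid_motion u)
      & real_dim (@rigid_motion R) 6]) /\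
  (* conformal Hessian complex *)
  (forall r : nat, (5 <= r)%N ->
    [/\ is_complex (@Pscal R r) (@PST R (r - 2)) (@PST R (r - 3))
          (@Pscal R (r - 5)) (@devhess R) (@symcurl R) (@divdiv R),
        exact_positive (@Pscal R r) (@PST R (r - 2)) (@PST R (r - 3))
          (@Pscal R (r - 5)) (@devhess R) (@symcurl R) (@divdiv R),
        (forall p : sfield R,
           H0 (@Pscal R r) (@devhess R) p <-> devhess p = 0)
      & real_dim (fun p : sfield R => devhess p = 0) 5]) /\
  (* conformal deformation complex *)
  (forall r : nat, (5 <= r)%N ->
    [/\ is_complex (@PV R r) (@PST R (r - 1)) (@PST R (r - 4))
          (@PV R (r - 5)) (@devdef R) (@cot R) (@div R),
        exact_positive (@PV R r) (@PST R (r - 1)) (@PST R (r - 4))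
          (@PV R (r - 5)) (@devdef R) (@cot R) (@div R),
        (forall u : vfield R,
           H0 (@PV R r) (@devdef R) u <-> devdef u = 0)
      & real_dim (fun u : vfield R => devdef u = 0) 10]).
Proof.
split; [|split].
- case=> [|[|[|[|s]]]] // _; rewrite !subSS !subn0.
  have cpx := elasticity_is_complex R s.
  split=> //; last exact: real_dim_rigid.
  - apply: exact_positive_of_complex cpx _ _ _.
    + exact: inc_exact.
    + exact: div_inc_exact.
    + exact: div_sym_surj.
  - move=> u; split=> [[_ /def_eq0 //]|/[dup] /def_eq0 u0 [a [b uE]]].
    by split=> //; rewrite uE; apply: PV_rigid.
- case=> [|[|[|[|[|s]]]]] // _; rewrite !subSS !subn0.
  have cpx := conformal_hessian_is_complex R s.
  split=> //; last exact: real_dim_devhess.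
  - apply: exact_positive_of_complex cpx _ _ _.
    + exact: symcurl_exact.
    + exact: divdiv_exact.
    + exact: divdiv_surj.
  - move=> p; split=> [[]//|/[dup] p0 /devhess_eq0[c [d [e pE]]]].
    by split=> //; rewrite pE; apply: Pscal_conformal_quadric.
- case=> [|[|[|[|[|s]]]]] // _; rewrite !subSS !subn0.
  have cpx := conformal_deformation_is_complex R s.
  split=> //; last exact: real_dim_devdef.
  - apply: exact_positive_of_complex cpx _ _ _.
    + exact: cot_exact.
    + exact: div_cot_exact.
    + exact: div_symtr0_surj.
  - move=> u; split=> [[]//|/[dup] u0 /devdef_eq0[a [b [c [d uE]]]]].
    by split=> //; rewrite uE; apply: PV_conformal_killing.
Qed.
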